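(* Fix an integer $l\ge 2$ and let $Z_U(M,N)$ denote the weighted number of paths from $(0,0)$ to $(M,N)$ in the lattice path model $\mathcal{L}_U$ described in the context. Let $k\ge 0$ be an integer and let $(M,N)$ be a point of the lattice with $M\ge 0$, $N\ge 0$, $M+N$ even and $lk-1\le M\le l(k+1)-2$. Then $$Z_U(M,N)=F^{(N)}_{M}+\sum_{j=1}^{\left\lfloor\frac{N-lk+1}{2l}+\frac{1}{2}\right\rfloor}F^{(N)}_{M-2lk-2jl}+\sum_{j=1}^{\left\lfloor\frac{N-lk+1}{2l}\right\rfloor}F^{(N)}_{M+2jl},$$ where $F^{(N)}_{m}=\binom{N}{\frac{N-m}{2}}-\binom{N}{\frac{N-m}{2}-1}$ and empty sums are $0$.
   Context: Lattice: $\mathcal{L}=\{(x,y)\in\mathbb{Z}^2: x+y\equiv 0 \pmod 2\}$. A lattice path model is given by a set of allowed steps $(x,y)\to(x',y+1)$ between lattice points, each with a positive weight. A path from $(0,0)$ to $(M,N)$ is a sequence $P_0=(0,0),P_1,\dots,P_N=(M,N)$ of lattice points with each $P_i\to P_{i+1}$ an allowed step; its weight is the product of the weights of its steps, and the weighted number of paths is the sum of the weights of all such paths ($0$ if there are none). Model $\mathcal{L}_U$ (depending on $l$): elementary steps are determined as follows. Left wall at $x=0$: from $(0,y)$ the only elementary step is $(0,y)\to(1,y+1)$, weight $1$. Filters of type 1 at $x=d$ for every $d=nl-1$, $n=1,2,3,\dots$: from $(d,y)$ the only elementary step is $(d,y)\to(d+1,y+1)$ with weight $1$; from $(d+1,y)$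 the only elementary steps are $(d+1,y)\to(d+2,y+1)$ with weight $1$ and $(d+1,y)\to(d,y+1)$ with weight $2$. From every other point $(x,y)$ the elementary steps are $(x,y)\to(x+1,y+1)$ and $(x,y)\to(x-1,y+1)$, each of weight $1$. In addition, for every integer $k\ge1$, $\mathcal{L}_U$ contains the long steps $(l(k+2)-2,\,lk-2+2m)\to(lk-1,\,lk-1+2m)$ for all integers $m\ge 0$, each of weight $1$. Binomial convention: $\binom{n}{x}=0$ unless $x$ is an integer with $0\le x\le n$. $\lfloor\cdot\rfloor$ is the integer part. *)

(* Defs.v *)
From mathcomp Require Export all_boot all_order all_algebra.
From mathcomp Require Export boolp classical_sets fsbigop.
Set Implicit Arguments.
Unset Strict Implicit.
Unset Printing Implicit Defensive.
Import Order.TTheory GRing.Theory Num.Theory.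
Local Open Scope classical_set_scope.
Local Open Scope ring_scope.

Definition point : Type := (int * int)%type.

Definition in_lattice (p : point) : bool := (2 %| p.1 + p.2)%Z.

Definition filter_at (l : nat) (d : int) : bool :=
  `[< exists n : nat, (1 <= n)%N /\ d = (n * l)%N%:Z - 1 >].

(* Weight of the elementary step (x, y) -> (x', y + 1), which does not depend
   on y; it is 0 when there is no such step. *)
Definition elementary_weight (l : nat) (x x' : int) : int :=
  if x == 0 then (if x' == 1 then 1 else 0)
  else if filter_at l x then (if x' == x + 1 then 1 else 0)
  else if filter_at l (x - 1) then
    (if x' == x + 1 then 1 else if x' == x - 1 then 2 else 0)
  else (if (x' == x + 1) || (x' == x - 1) then 1 else 0).

Definition long_step (l : nat) (p q : point) : bool :=
  `[< exists k m : nat, [/\ (1 <= k)%N,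
        p = ((l * (k + 2))%N%:Z - 2, (l * k)%N%:Z - 2 + (2 * m)%N%:Z) &
        q = ((l * k)%N%:Z - 1, (l * k)%N%:Z - 1 + (2 * m)%N%:Z)] >].

(* 0 when p -> q is not a step. For l >= 2 a long step changes the abscissa by
   1 - 2 l <= -3, so it never coincides with an elementary one. *)
Definition step_weight (l : nat) (p q : point) : int :=
  if [&& in_lattice p, in_lattice q & q.2 == p.2 + 1] then
    (if long_step l p q then 1 else elementary_weight l p.1 q.1)
  else 0.

Definition allowed_step (l : nat) : rel point :=
  fun p q => 0 < step_weight l p q.

Definition origin : point := (0, 0).

(* A path P_0 = (0, 0), P_1, ..., P_N = (M, N) is encoded by the sequence
   [:: P_1; ...; P_N]. *)
Definition paths_to (l M N : nat) : set (seq point) :=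
  [set s | [/\ size s = N, path (allowed_step l) origin s
             & last origin s = (M%:Z, N%:Z)]].

Definition path_weight (l : nat) (s : seq point) : int :=
  \prod_(w <- pairmap (step_weight l) origin s) w.

Definition Z_U (l M N : nat) : int :=
  \sum_(s \in paths_to l M N) path_weight l s.

(* The binomial coefficient with the convention that it vanishes unless x is
   an integer with 0 <= x <= n; 'C(n, k) is already 0 for k > n. *)
Definition binomq (n : nat) (x : rat) : int :=
  if x \is a Num.nat then ('C(n, Num.truncn x))%:Z else 0.

Definition F (N : nat) (m : int) : int :=
  binomq N ((N%:Z - m)%:Q / 2) - binomq N ((N%:Z - m)%:Q / 2 - 1).

(* The sum of f j over the integers 1 <= j <= n, empty for n <= 0. *)
Definition sum_from1 (n : int) (f : nat -> int) : int :=
  if n is Posz n' then \sum_(1 <= j < n'.+1) f j else 0.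

(* Main.v *)
Require Import Defs.
From mathcomp Require Import zify ring.
Import Order.TTheory GRing.Theory Num.Theory.
Local Open Scope ring_scope.

(** The ballot numbers satisfy F^(N+1)_m = F^(N)_(m-1) + F^(N)_(m+1) and
    F_(-2-m) = - F_m, and F^(N)_m vanishes for m > N. The bounds of the two sums
    are exactly those beyond which all terms vanish, so with
    A_m := sum_(j >= 0) F_(m + 2 j l) the right-hand side is
    G_k(M) := A_M - A_(2 l (k+1) - 2 - M). It remains to see that G obeys the
    transfer recurrence of the model. Inside the strip this is the recurrence of
    F; at its right end G_k(l (k+1) - 1) = 0 replaces the missing step out of
    the filter; at its left end M = l k - 1 the steps from the left, from the
    right (weight 2) and the long step add up to
    A_(lk-2) - A_(lk) + 2 (A_(lk) - A_(l(k+2)-2)) + A_(l(k+2)-2) - A_(l(k+2))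
    = F_(lk-2) + F_(lk), because A_m - A_(m + 2l) = F_m. In the proof A is cut
    off at a number K of terms larger than all heights N involved. *)

(** * Ballot numbers: recurrence, antisymmetry, vanishing *)

Lemma binomq0 (x : rat) : binomq 0 x = (x == 0)%:Z.
Proof.
rewrite /binomq; case: natrP => [[[|n] ->]|nx]; rewrite ?natrK ?bin0n ?pnatr_eq0 //.
by case: eqP => // x0; case: nx; exists 0%N.
Qed.

Lemma binomqS (n : nat) (x : rat) : binomq n.+1 x = binomq n x + binomq n (x - 1).
Proof.
rewrite /binomq; case: natrP => [[[|m] ->]|nx]; last first.
- case: natrP => [[m xm]|_] //; case: nx; exists m.+1.
  by rewrite -natr1 -xm subrK.
- by rewrite -natr1 addrK natr_nat natr1 !natrK binS PoszD.
- case: natrP => [[m /eqP]|_]; rewrite ?natrK ?bin0 //.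
  by rewrite subr_eq natr1 eq_sym pnatr_eq0.
Qed.

Lemma F0E (m : int) : F 0 m = (m == 0)%:Z - (m == -2)%:Z.
Proof.
rewrite /F !binomq0 sub0r; congr (Posz (nat_of_bool _) - Posz (nat_of_bool _)).
  by rewrite mulf_eq0 invr_eq0 orbF intr_eq0 oppr_eq0.
apply/idP/idP => [|/eqP -> //].
rewrite subr_eq0 (can2_eq (mulfVK _) (mulfK _)) // mul1r.
by rewrite -[2]/(2%:~R) eqr_int eqr_oppLR.
Qed.

Lemma FS (n : nat) (m : int) : F n.+1 m = F n (m - 1) + F n (m + 1).
Proof.
rewrite /F !binomqS.
have -> : (n.+1%:Z - m)%:Q / 2 = (n%:Z - (m - 1))%:Q / 2.
  by congr (_%:~R / 2); lia.
have -> : (n%:Z - (m + 1))%:Q / 2 = (n%:Z - (m - 1))%:Q / 2 - 1.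
  by rewrite !(rmorphB, rmorphD) /=; field.
by ring.
Qed.

(** At height 0 the values 1 at 0 and -1 at -2 are swapped up to sign, and the recurrence commutes
    with the reflection about -1. *)
Lemma F_anti (n : nat) (m : int) : F n (- 2 - m) = - F n m.
Proof.
elim: n m => [|n IHn] m; first by rewrite !F0E; lia.
rewrite !FS [RHS]opprD -!IHn addrC; congr (F n _ + F n _); lia.
Qed.

Lemma F_gt (n : nat) (m : int) : n%:Z < m -> F n m = 0.
Proof.
elim: n m => [|n IHn] m ltnm; first by rewrite F0E; lia.
by rewrite FS !IHn //; lia.
Qed.

Lemma F_N1 (n : nat) : F n (-1) = 0.
Proof. by have := F_anti n (-1); rewrite (_ : -2 - -1 = -1) //; lia. Qed.

(** * Truncated sums over images *)

Section Images.

Variables l K : nat.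

Definition image_sum (n : nat) (m : int) : int :=
  \sum_(j < K) F n (m + (2 * j * l)%N%:Z).

Lemma image_sumS (n : nat) (m : int) :
  image_sum n.+1 m = image_sum n (m - 1) + image_sum n (m + 1).
Proof.
rewrite /image_sum -big_split; apply: eq_bigr => j _ /=.
by rewrite FS; congr (F n _ + F n _); lia.
Qed.

Lemma image_sum_gt (n : nat) (m : int) : n%:Z < m -> image_sum n m = 0.
Proof. by move=> ltnm; apply: big1 => j _; apply: F_gt; lia. Qed.

(** Telescoping; the hypothesis kills the one term left over at the cutoff. *)
Lemma image_sum_shift (n : nat) (m : int) :
  n%:Z < m + (2 * K * l)%N%:Z ->
  image_sum n m = F n m + image_sum n (m + (2 * l)%N%:Z).
Proof.
rewrite /image_sum; case: K => [|k] ltnm.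
  by rewrite !big_ord0 addr0 F_gt //; lia.
rewrite big_ord_recl [in RHS]big_ord_recr /=.
rewrite (_ : m + (2 * l)%N%:Z + _ = m + (2 * k.+1 * l)%N%:Z); last by lia.
rewrite (F_gt _ _ ltnm) !addr0; congr (_ + _).
by apply: eq_bigr => j _; congr (F n _); rewrite /= /bump; lia.
Qed.

(* Antisymmetric about the filter x = l (k + 1) - 1 that bounds the k-th strip
   on the right. *)
Definition strip_sum (k n : nat) (x : int) : int :=
  image_sum n x - image_sum n ((2 * l * k.+1)%N%:Z - 2 - x).

Lemma strip_sumS (k n : nat) (x : int) :
  strip_sum k n.+1 x = strip_sum k n (x - 1) + strip_sum k n (x + 1).
Proof.
rewrite /strip_sum !image_sumS.
rewrite (_ : _ - x - 1 = (2 * l * k.+1)%N%:Z - 2 - (x + 1)); last by lia.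
rewrite (_ : _ - x + 1 = (2 * l * k.+1)%N%:Z - 2 - (x - 1)); last by lia.
by lia.
Qed.

Lemma strip_sum_wall (k n : nat) : strip_sum k n ((l * k.+1)%N%:Z - 1) = 0.
Proof.
apply/eqP; rewrite subr_eq0; apply/eqP; congr (image_sum n _); lia.
Qed.

(** The left end and its mirror image differ by exactly one period 2 l. *)
Lemma strip_sum_left (k n : nat) : (2 <= l)%N -> (n < K)%N ->
  strip_sum k n ((l * k)%N%:Z - 1) = F n ((l * k)%N%:Z - 1).
Proof.
move=> l_ge2 ltnK; rewrite /strip_sum image_sum_shift; last by nia.
rewrite (_ : _ - 1 + _ = (2 * l * k.+1)%N%:Z - 2 - ((l * k)%N%:Z - 1)); last by lia.
exact: addrK.
Qed.

Lemma strip_sum0 (k : nat) (x : int) : (2 <= l)%N -> (0 < K)%N ->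
  0 <= x <= (l * k.+1)%N%:Z - 2 -> strip_sum k 0 x = (x == 0)%:Z.
Proof.
move=> l_ge2 K0 x_k; rewrite /strip_sum [image_sum 0 (_ - x)]image_sum_gt; last by lia.
rewrite image_sum_shift; last by nia.
by rewrite image_sum_gt ?F0E; lia.
Qed.

(* The flow into the filter at l k - 1, k >= 1: from its left, doubled from
   its right, and along the long step. *)
Lemma strip_sum_filter (k n : nat) : (n < K)%N ->
  strip_sum k.+1 n.+1 ((l * k.+1)%N%:Z - 1) =
    strip_sum k n ((l * k.+1)%N%:Z - 2) + 2 * strip_sum k.+1 n (l * k.+1)%N%:Z
    + strip_sum k.+2 n ((l * k.+3)%N%:Z - 2).
Proof.
move=> ltnK; rewrite strip_sumS /strip_sum.
set a := (l * k.+1)%N%:Z.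
have -> : (2 * l * k.+1)%N%:Z - 2 - (a - 2) = a by lia.
have -> : (2 * l * k.+2)%N%:Z - 2 - a = a - 2 + (2 * l)%N%:Z by lia.
have -> : (2 * l * k.+2)%N%:Z - 2 - (a - 1 + 1) = a - 2 + (2 * l)%N%:Z by lia.
have -> : (2 * l * k.+2)%N%:Z - 2 - (a - 1 - 1) = a + (2 * l)%N%:Z by lia.
have -> : (2 * l * k.+3)%N%:Z - 2 - ((l * k.+3)%N%:Z - 2) = a + (2 * l)%N%:Z by lia.
have -> : (l * k.+3)%N%:Z - 2 = a - 2 + (2 * l)%N%:Z by lia.
have -> : a - 1 + 1 = a by lia.
have -> : a - 1 - 1 = a - 2 by lia.
by lia.
Qed.

End Images.

(** * Finite enumeration of paths and the transfer recurrence *)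

Lemma filter_atE (l k : nat) (x : int) :
  (l * k)%N%:Z - 1 <= x <= (l * k.+1)%N%:Z - 2 ->
  filter_at l x = (0 < k)%N && (x == (l * k)%N%:Z - 1).
Proof.
move=> x_k; apply/asboolP/idP => [[n [n1 xE]]|/andP[k0 /eqP ->]].
  have nk : n = k by nia.
  by rewrite -nk n1 xE mulnC eqxx.
by exists k; rewrite mulnC.
Qed.

Definition step_targets (l : nat) (p : point) : seq point :=
  [:: (p.1 + 1, p.2 + 1); (p.1 - 1, p.2 + 1); (p.1 + 1 - (2 * l)%N%:Z, p.2 + 1)].

Definition step_sources (l : nat) (q : point) : seq point :=
  [:: (q.1 - 1, q.2 - 1); (q.1 + 1, q.2 - 1); (q.1 - 1 + (2 * l)%N%:Z, q.2 - 1)].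

Lemma step_targets_sources (l : nat) (p q : point) :
  (q \in step_targets l p) = (p \in step_sources l q).
Proof.
case: p q => [a b] [c d]; rewrite !inE /= !xpair_eqE /=.
by congr [|| _, _ | _]; lia.
Qed.

Lemma step_weight_target (l : nat) (p q : point) :
  step_weight l p q != 0 -> q \in step_targets l p.
Proof.
case: p q => [a b] [c d]; rewrite /step_weight /=; case: ifP => // /and3P[_ _ /eqP ->].
rewrite !inE !xpair_eqE !eqxx !andbT /=.
case: ifP => [/asboolP[k [m [_ [-> _] [-> _]]]] _|_]; first by lia.
rewrite /elementary_weight; do 6?case: ifP => //; lia.
Qed.

Lemma step_weight_ge0 (l : nat) (p q : point) : 0 <= step_weight l p q.
Proof.
rewrite /step_weight /elementary_weight.
by do 9?case: ifP => //.
Qed.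

(** A finite list containing all paths with N steps. Its members that are not paths have weight 0,
    so sums may run over the whole list. *)
Fixpoint candidates (l N : nat) : seq (seq point) :=
  if N is n.+1 then
    [seq rcons s q | s <- candidates l n, q <- step_targets l (last origin s)]
  else [:: [::]].

Lemma candidates_uniq (l N : nat) : (2 <= l)%N -> uniq (candidates l N).
Proof.
move=> l_ge2; elim: N => // N IHN; apply: allpairs_uniq_dep => //.
  (* For l = 1 the target of a long step would coincide with that of a left step. *)
  move=> s _; rewrite /= !inE !xpair_eqE; lia.
by move=> [s p] [t q] _ _ /= /rcons_inj[-> ->].
Qed.

Lemma size_candidates (l N : nat) (s : seq point) :
  s \in candidates l N -> size s = N.
Proof.
elim: N s => [|N IHN] s; first by rewrite inE => /eqP ->.
by case/allpairsPdep => [t [q [/IHN tN _ ->]]]; rewrite size_rcons tN.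
Qed.

Lemma mem_candidates (l : nat) (s : seq point) :
  path (allowed_step l) origin s -> s \in candidates l (size s).
Proof.
elim/last_ind: s => // s q IHs; rewrite rcons_path size_rcons => /andP[/IHs ss].
rewrite /allowed_step => w0; apply/allpairsPdep; exists s, q; split => //.
by apply: step_weight_target; rewrite gt_eqF.
Qed.

Lemma path_weight_rcons (l : nat) (s : seq point) (q : point) :
  path_weight l (rcons s q) = path_weight l s * step_weight l (last origin s) q.
Proof. by rewrite /path_weight -cats1 pairmap_cat big_cat /= big_seq1. Qed.

Lemma path_weight_eq0 (l : nat) (s : seq point) :
  ~~ path (allowed_step l) origin s -> path_weight l s = 0.
Proof.
elim/last_ind: s => // s q IHs; rewrite rcons_path path_weight_rcons negb_and.
case/orP => [/IHs ->|]; first by rewrite mul0r.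
rewrite /allowed_step -leNgt => w0; apply/eqP; rewrite mulf_eq0; apply/orP; right.
by rewrite eq_le w0 step_weight_ge0.
Qed.

Definition weight_to (l N : nat) (q : point) : int :=
  \sum_(s <- candidates l N | last origin s == q) path_weight l s.

Lemma Z_UE (l M N : nat) : (2 <= l)%N -> Z_U l M N = weight_to l N (M%:Z, N%:Z).
Proof.
move=> l_ge2; rewrite /Z_U /weight_to.
pose P s := path (allowed_step l) origin s && (last origin s == (M%:Z, N%:Z)).
have -> : paths_to l M N = [set` [seq s <- candidates l N | P s]]%classic.
  apply/seteqP; split => s /=; rewrite mem_filter.
    by case=> sN sp sl; rewrite /P sp sl eqxx -sN mem_candidates.
  by case/andP => /andP[sp /eqP sl] /size_candidates sN; split.
rewrite -fsbig_seq ?filter_uniq ?candidates_uniq // big_filter.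
rewrite big_mkcond [RHS]big_mkcond; apply: eq_bigr => s _; rewrite /P.
by case: (boolP (path _ _ _)) => //= /path_weight_eq0 ->; rewrite if_same.
Qed.

(** Both sides equal the sum over all candidates [s] with N steps of the weight of [s] times that of
    the step from its last point to [q]. *)
Lemma weight_toS (l N : nat) (q : point) : (2 <= l)%N ->
  weight_to l N.+1 q = \sum_(p <- step_sources l q) weight_to l N p * step_weight l p q.
Proof.
move=> l_ge2; rewrite /weight_to big_mkcond.
rewrite [LHS]big_allpairs_dep.
transitivity (\sum_(s <- candidates l N)
    path_weight l s * step_weight l (last origin s) q).
  apply: eq_bigr => s _; set p := last origin s.
  have tu : uniq (step_targets l p) by rewrite /= !inE !xpair_eqE; lia.
  under eq_bigr => r _ do rewrite last_rcons path_weight_rcons -/p.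
  rewrite -big_mkcond /=; case: (boolP (q \in step_targets l p)) => qp.
    by rewrite big_mkcond (bigD1_seq q) //= eqxx big1 ?addr0 // => i /negPf ->.
  rewrite big1_seq => [|r /andP[/eqP -> qp']]; last by rewrite qp' in qp.
  by case: eqP (contra (@step_weight_target l p q) qp) => // ->; rewrite mulr0.
under [RHS]eq_bigr => p _ do rewrite mulr_suml big_mkcond /=.
rewrite exchange_big /=; apply: eq_bigr => s _; set p := last origin s.
have su : uniq (step_sources l q) by rewrite /= !inE !xpair_eqE; lia.
case: (boolP (p \in step_sources l q)) => pq.
  rewrite (bigD1_seq p) //= eqxx big1 ?addr0 // => i.
  by rewrite eq_sym => /negPf ->.
rewrite big1_seq => [|r /andP[_ rq]]; last by case: eqP => // pr; rewrite pr rq in pq.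
rewrite -step_targets_sources in pq.
by case: eqP (contra (@step_weight_target l p q) pq) => // ->; rewrite mulr0.
Qed.

(** * Weights of the steps into a given point *)

Lemma long_step_filter (l : nat) (p q : point) :
  long_step l p q -> filter_at l q.1 /\ p.1 = q.1 - 1 + (2 * l)%N%:Z.
Proof.
move=> /asboolP[k [m [k1 -> ->]]]; split; last by rewrite /=; lia.
by apply/asboolP; exists k; split; rewrite //= mulnC.
Qed.

Lemma filter_at_gt0 (l : nat) (x : int) : (2 <= l)%N -> filter_at l x -> 0 < x.
Proof. by move=> l_ge2 /asboolP[n [n1 ->]]; nia. Qed.

Lemma step_weight_right (l : nat) (x y : int) : (2 <= l)%N ->
  0 < x -> (2 %| x + y)%Z -> step_weight l (x - 1, y - 1) (x, y) = 1.
Proof.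
move=> l_ge2 x0 xy; rewrite /step_weight ifT; last first.
  by rewrite /in_lattice /=; apply/and3P; split; lia.
case: ifP => // _; rewrite /elementary_weight /= subrK eqxx.
by case: eqP => [x1|_]; [rewrite ifT //; lia | do 2?case: ifP].
Qed.

Lemma step_weight_left (l : nat) (x y : int) : (2 <= l)%N ->
  0 <= x -> (2 %| x + y)%Z ->
  step_weight l (x + 1, y - 1) (x, y) =
    if filter_at l (x + 1) then 0 else if filter_at l x then 2 else 1.
Proof.
move=> l_ge2 x0 xy; rewrite /step_weight ifT; last first.
  by rewrite /in_lattice /=; apply/and3P; split; lia.
rewrite ifF; last by apply/negP => /long_step_filter[_ /=]; lia.
rewrite /elementary_weight /= addrK eqxx orbT.
have -> : (x + 1 == 0) = false by lia.
have -> : (x == x + 1 + 1) = false by lia.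
by [].
Qed.

Lemma step_weight_nolong (l : nat) (x y y' : int) : (2 <= l)%N ->
  ~~ filter_at l x -> step_weight l (x - 1 + (2 * l)%N%:Z, y) (x, y') = 0.
Proof.
move=> l_ge2 xl; rewrite /step_weight; case: ifP => // _.
rewrite ifF; last by apply/negP => /long_step_filter[/= xl' _]; rewrite xl' in xl.
by rewrite /elementary_weight /=; do 6?case: ifP => //; lia.
Qed.

Lemma step_weight_long (l k : nat) (x y : int) : (0 < k)%N ->
  x = (l * k)%N%:Z - 1 -> x <= y -> (2 %| x + y)%Z ->
  step_weight l (x - 1 + (2 * l)%N%:Z, y - 1) (x, y) = 1.
Proof.
move=> k0 xk lexy xy; rewrite /step_weight ifT; last first.
  by rewrite /in_lattice /=; apply/and3P; split; lia.
(* Solves y = l k - 1 + 2 m for m, a natural number by parity and [x <= y]. *)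
rewrite ifT //; apply/asboolP; exists k, (absz (y - x) %/ 2)%N.
by split => //; congr (_, _); lia.
Qed.

(** * Solution of the transfer recurrence *)

Lemma weight_to_lt0 (l N : nat) (x : int) : (2 <= l)%N ->
  x < 0 -> weight_to l N (x, N%:Z) = 0.
Proof.
move=> l_ge2; elim: N x => [|N IHN] x x0.
  rewrite /weight_to big_cons big_nil /= ifF //.
  by apply/negP => /eqP[x00]; rewrite -x00 in x0.
have nfx : ~~ filter_at l x by apply/negP => /(filter_at_gt0 _ _ l_ge2); lia.
rewrite weight_toS // !big_cons big_nil /= (_ : N.+1%:Z - 1 = N%:Z); last by lia.
rewrite IHN; last by lia.
rewrite step_weight_nolong // mul0r mulr0 !addr0 add0r.
have [x1|x1] := ltP (x + 1) 0; first by rewrite IHN ?mul0r.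
have -> : x = -1 by lia.
rewrite /step_weight; case: ifP => [_|]; last by rewrite mulr0.
rewrite ifF ?mulr0 //.
by apply/negP => /long_step_filter[/(filter_at_gt0 _ _ l_ge2)].
Qed.

(** Induction on the height for all strips at once, as a filter is fed from three strips. Since
    strip 0 formally starts at -1, [0 <= x] is a separate hypothesis. *)
Lemma weight_to_strip (l K N k : nat) (x : int) : (2 <= l)%N -> (N < K)%N ->
  0 <= x -> (l * k)%N%:Z - 1 <= x <= (l * k.+1)%N%:Z - 2 -> (2 %| x + N%:Z)%Z ->
  weight_to l N (x, N%:Z) = strip_sum l K k N x.
Proof.
move=> l_ge2; elim: N k x => [|N IHN] k x ltNK x0 x_k xN.
  rewrite strip_sum0 //; last by lia.
  rewrite /weight_to big_cons big_nil /= /origin xpair_eqE eqxx andbT eq_sym.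
  by case: (x == 0); rewrite ?addr0 // /path_weight big_nil.
have ltNK' : (N < K)%N by lia.
have weightN k' x' : 0 <= x' -> (l * k')%N%:Z - 1 <= x' <= (l * k'.+1)%N%:Z - 2 ->
    (2 %| x' + N%:Z)%Z -> weight_to l N (x', N%:Z) = strip_sum l K k' N x'.
  exact: IHN.
rewrite weight_toS // !big_cons big_nil /= addr0.
rewrite step_weight_left // (filter_atE _ k x) //.
have N1E : N.+1%:Z - 1 = N%:Z by lia.
have [/andP[k0 /eqP xE]|xE] := boolP (_ && _).
  case: k k0 x_k xE => // k _ x_k xE.
  have lkS : (l * k.+1 = l * k + l)%N by lia.
  have lkSS : (l * k.+2 = l * k + l + l)%N by lia.
  have lkSSS : (l * k.+3 = l * k + l + l + l)%N by lia.
  rewrite step_weight_right //; last by lia.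
  rewrite xE strip_sum_filter // (filter_atE _ k.+1); last by lia.
  rewrite ifF; last by lia.
  rewrite N1E mulr1 addrA; congr (_ + _ + _).
  - rewrite (_ : _ - 1 - 1 = (l * k.+1)%N%:Z - 2); last by lia.
    by apply: weightN; lia.
  - rewrite subrK mulrC; congr (_ * _); apply: weightN; lia.
  - rewrite (_ : _ - 1 - 1 + _ = (l * k.+3)%N%:Z - 2); last by lia.
    rewrite (weightN k.+2); [|lia..].
    (* Long steps exist only from a certain height on; below it their source is out of reach and
       both image sums vanish there. *)
    have [lekN|ltNk] := leP ((l * k.+1)%N%:Z - 1) N.+1%:Z.
      have := @step_weight_long l k.+1 x N.+1%:Z isT xE.
      rewrite xE N1E (_ : _ - 1 - 1 + _ = (l * k.+3)%N%:Z - 2); last by lia.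
      by move=> ->; rewrite ?mulr1 //; lia.
    by rewrite /strip_sum !image_sum_gt ?mul0r //; lia.
have nfx : ~~ filter_at l x by rewrite (filter_atE _ k).
rewrite N1E step_weight_nolong // mulr0 addr0 strip_sumS.
have lkS : (l * k.+1 = l * k + l)%N by lia.
have lkSS : (l * k.+2 = l * k + l + l)%N by lia.
congr (_ + _).
  (* At the wall nothing arrives from the left, matching the value F_(-1) = 0 of the strip sum at
     -1. *)
  have [x00|x_gt0] := leP x 0.
    have k0 : k = 0%N by nia.
    have -> : x - 1 = (l * k)%N%:Z - 1 by lia.
    by rewrite strip_sum_left // k0 muln0 F_N1 weight_to_lt0 ?mul0r.
  have := step_weight_right l x N.+1%:Z l_ge2 x_gt0 xN; rewrite N1E => ->.
  by rewrite mulr1; apply: weightN; lia.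
have [x1|x1] := ltP (x + 1) ((l * k.+1)%N%:Z - 1).
  rewrite (filter_atE _ k); last by lia.
  rewrite ifF ?mulr1; last by lia.
  by apply: weightN; lia.
rewrite (filter_atE _ k.+1); last by lia.
rewrite ifT ?mulr0; last by lia.
by rewrite (_ : x + 1 = (l * k.+1)%N%:Z - 1) ?strip_sum_wall //; lia.
Qed.

(** * The bounds of the two sums *)

Lemma sum_from1E (n : int) (f : nat -> int) (K : nat) :
  (forall j : nat, n < j.+1%:Z -> f j.+1 = 0) ->
  (forall j : nat, (K <= j)%N -> f j.+1 = 0) ->
  sum_from1 n f = \sum_(j < K) f j.+1.
Proof.
move=> fn fK; case: n fn => [n|n] fn; last first.
  by rewrite big1 // => j _; apply: fn.
have truncate a b : (a <= b)%N -> (forall j, (a <= j)%N -> f j.+1 = 0) ->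
    \sum_(j < b) f j.+1 = \sum_(j < a) f j.+1.
  move=> /subnK <- fa; rewrite addnC big_split_ord /= [X in _ + X]big1 ?addr0 //.
  by move=> j _; apply: fa; apply: leq_addr.
rewrite /sum_from1 big_add1 big_mkord /=.
have [lenK|ltKn] := leqP n K; first by rewrite (truncate n K).
by rewrite (truncate K n) // ltnW.
Qed.

Theorem theorem6p2 (l : nat) (hl : (2 <= l)%N) (k M N : nat)
    (hMN : ~~ odd (M + N))
    (hM : (l * k)%N%:Z - 1 <= M%:Z <= (l * (k + 1))%N%:Z - 2) :
  Z_U l M N =
    F N M%:Z
    + sum_from1
        (Num.floor ((N%:Z - (l * k)%N%:Z + 1)%:Q / (2 * l)%N%:Q + 1 / 2))
        (fun j => F N (M%:Z - (2 * l * k)%N%:Z - (2 * j * l)%N%:Z))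
    + sum_from1
        (Num.floor ((N%:Z - (l * k)%N%:Z + 1)%:Q / (2 * l)%N%:Q))
        (fun j => F N (M%:Z + (2 * j * l)%N%:Z)).
Proof.
(* Antisymmetry turns the images on the left into those of the mirror point, with the index shifted
   by one. *)
have FL j : F N (M%:Z - (2 * l * k)%N%:Z - (2 * j.+1 * l)%N%:Z) =
    - F N ((2 * l * k.+1)%N%:Z - 2 - M%:Z + (2 * j * l)%N%:Z).
  by rewrite -F_anti; congr (F N _); lia.
have l0 : 0 < (2 * l)%N%:Q by rewrite ltr0z; lia.
rewrite Z_UE // (weight_to_strip l N.+1 N k) //; [|lia..].
rewrite (sum_from1E _ _ N.+1); first last.
- by move=> j ltNj; rewrite FL F_gt ?oppr0 //; nia.
- move=> j; rewrite floor_lt_int => ltj.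
  (* With M <= l (k + 1) - 2 this puts the mirrored argument above N; the summand 1/2 in the bound
     becomes the extra l. *)
  have {ltj} ltj : N%:Z - (l * k)%N%:Z + 1 + l%:Z < (2 * j.+1 * l)%N%:Z.
    have half : 1 / 2 * (2 * l)%N%:Q = l%:Q by rewrite PoszM rmorphM /=; field.
    move: ltj; rewrite -(ltr_pM2r l0) mulrDl divfK ?gt_eqF // half.
    by rewrite -rmorphD -rmorphM /= ltr_int; lia.
  by rewrite FL F_gt ?oppr0 //; lia.
(* One term fewer than in the first sum: the term j = 0 of [image_sum] is the leading [F N M]. *)
rewrite (sum_from1E _ _ N); first last.
- by move=> j ltNj; rewrite F_gt //; nia.
- move=> j; rewrite floor_lt_int => ltj.
  have {ltj} ltj : N%:Z - (l * k)%N%:Z + 1 < (2 * j.+1 * l)%N%:Z.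
    move: ltj; rewrite -(ltr_pM2r l0) divfK ?gt_eqF //.
    by rewrite -rmorphM /= ltr_int; lia.
  by rewrite F_gt //; lia.
rewrite /strip_sum /image_sum [RHS]addrAC big_ord_recl /= addr0; congr (_ + _).
by rewrite -sumrN; apply: eq_bigr => j _; rewrite FL.
Qed.
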